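(* The category of systems $(A,p,0,1)$ consisting of a set $A$, a ternary operation $p:A\times A\times A\to A$ and two constants $0,1\in A$ satisfying axioms (T1)--(T5) is isomorphic to the category of de Morgan algebras.
   Context: Axioms, for all $a,b,c,b_1,b_2,b_3\in A$: (T1) $p(0,a,1)=a$; (T2) $p(a,0,b)=a=p(b,1,a)$; (T3) $p(a,b,a)=a$; (T4) $p(a,p(b_1,b_2,b_3),c)=p(p(a,b_1,c),b_2,p(a,b_3,c))$; (T5) $p(0,a,b)=p(0,b,a)$ and $p(0,a,a)=a$. A morphism of such systems is a map $f$ with $f(0)=0$, $f(1)=1$ and $f(p(a,b,c))=p(f(a),f(b),f(c))$. A de Morgan algebra $(A,\cdot,\circ,\overline{()},0,1)$ is a bounded distributive lattice (meet $\cdot$, join $\circ$, bottom $0$, top $1$) together with an involution $\overline{()}$ (i.e. $\overline{\overline a}=a$) satisfying $\overline{a\cdot b}=\bar b\circ\bar a$ for all $a,b$; morphisms of de Morgan algebras are the usual homomorphisms, preserving $\cdot,\circ,\overline{()},0,1$. *)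

(* Defs.v *)
From mathcomp Require Import ssreflect ssrfun ssrbool.
From Stdlib Require Import ProofIrrelevance.

Set Implicit Arguments.
Unset Strict Implicit.
Unset Printing Implicit Defensive.

Record category := Category {
  obj : Type;
  hom : obj -> obj -> Type;
  idm : forall a, hom a a;
  comp : forall a b c, hom b c -> hom a b -> hom a c;
  comp_idl : forall a b (f : hom a b), comp (idm b) f = f;
  comp_idr : forall a b (f : hom a b), comp f (idm a) = f;
  comp_assoc : forall a b c d (h : hom c d) (g : hom b c) (f : hom a b),
    comp h (comp g f) = comp (comp h g) f }.

Arguments hom : clear implicits.
Arguments idm : clear implicits.

Record functor (C D : category) := Functor {
  fobj : obj C -> obj D;
  fmor : forall a b, hom C a b -> hom D (fobj a) (fobj b);
  fmor_id : forall a, fmor (idm C a) = idm D (fobj a);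
  fmor_comp : forall a b c (g : hom C b c) (f : hom C a b),
    fmor (comp g f) = comp (fmor g) (fmor f) }.

Definition functor_id (C : category) : functor C C :=
  @Functor C C (fun a => a) (fun a b f => f)
    (fun a => erefl) (fun a b c g f => erefl).

Section FunctorComp.
Variables (C D E : category) (G : functor D E) (F : functor C D).

Let fo a := fobj G (fobj F a).
Let fm a b (f : hom C a b) : hom E (fo a) (fo b) := fmor G (fmor F f).

Lemma functor_comp_id a : fm (idm C a) = idm E (fo a).
Proof. by rewrite /fm !fmor_id. Qed.

Lemma functor_comp_comp a b c (g : hom C b c) (f : hom C a b) :
  fm (comp g f) = comp (fm g) (fm f).
Proof. by rewrite /fm !fmor_comp. Qed.

Definition functor_comp : functor C E :=
  Functor functor_comp_id functor_comp_comp.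
End FunctorComp.

(* Isomorphism, not mere equivalence: the composites are Leibniz-equal to the
   identity functors, on objects as well as on morphisms. *)
Definition isomorphic_categories (C D : category) : Prop :=
  exists (F : functor C D) (G : functor D C),
    functor_comp G F = functor_id C /\ functor_comp F G = functor_id D.

Record ternary_system := TernarySystem {
  tcar :> Type;
  tp : tcar -> tcar -> tcar -> tcar;
  t0 : tcar;
  t1 : tcar;
  tp_01 : forall a, tp t0 a t1 = a;
  tp_left : forall a b, tp a t0 b = a;
  tp_right : forall a b, tp b t1 a = a;
  tp_same : forall a b, tp a b a = a;
  tp_tp : forall a b1 b2 b3 c,
    tp a (tp b1 b2 b3) c = tp (tp a b1 c) b2 (tp a b3 c);
  tp_0C : forall a b, tp t0 a b = tp t0 b a;
  tp_0xx : forall a, tp t0 a a = a }.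

Arguments t0 : clear implicits.
Arguments t1 : clear implicits.

Record ternary_hom (A B : ternary_system) := TernaryHom {
  tfun :> A -> B;
  tfun0 : tfun (t0 A) = t0 B;
  tfun1 : tfun (t1 A) = t1 B;
  tfunp : forall a b c, tfun (tp a b c) = tp (tfun a) (tfun b) (tfun c) }.

Lemma ternary_hom_eq (A B : ternary_system) (f g : ternary_hom A B) :
  tfun f = tfun g -> f = g.
Proof.
case: f g => [f f0 f1 fp] [g g0 g1 gp] /= E; subst g.
by congr TernaryHom; apply: proof_irrelevance.
Qed.

Definition ternary_id (A : ternary_system) : ternary_hom A A :=
  @TernaryHom A A (fun x => x) erefl erefl (fun a b c => erefl).

Definition ternary_comp (A B C : ternary_system)
    (g : ternary_hom B C) (f : ternary_hom A B) : ternary_hom A C.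
Proof.
exists (fun x => g (f x)).
- by rewrite !tfun0.
- by rewrite !tfun1.
- by move=> a b c; rewrite !tfunp.
Defined.

Definition ternary_category : category.
Proof.
exists ternary_system ternary_hom ternary_id ternary_comp.
- by move=> A B f; apply: ternary_hom_eq.
- by move=> A B f; apply: ternary_hom_eq.
- by move=> A B C D h g f; apply: ternary_hom_eq.
Defined.

(* MathComp's distributive lattices live on a choiceType; here the carrier is
   an arbitrary type, with no decidable equality or choice operator. *)
Record demorgan_algebra := DeMorganAlgebra {
  dcar :> Type;
  dmeet : dcar -> dcar -> dcar;
  djoin : dcar -> dcar -> dcar;
  dneg : dcar -> dcar;
  d0 : dcar;
  d1 : dcar;
  dmeetA : associative dmeet;
  dmeetC : commutative dmeet;
  djoinA : associative djoin;
  djoinC : commutative djoin;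
  dmeet_joinK : forall a b, dmeet a (djoin a b) = a;
  djoin_meetK : forall a b, djoin a (dmeet a b) = a;
  dmeet_joinr : right_distributive dmeet djoin;
  djoin0 : right_id d0 djoin;
  dmeet1 : right_id d1 dmeet;
  dnegK : involutive dneg;
  dneg_meet : forall a b, dneg (dmeet a b) = djoin (dneg b) (dneg a) }.

Arguments d0 : clear implicits.
Arguments d1 : clear implicits.

Record demorgan_hom (A B : demorgan_algebra) := DeMorganHom {
  dfun :> A -> B;
  dfun_meet : {morph dfun : a b / dmeet a b >-> dmeet a b};
  dfun_join : {morph dfun : a b / djoin a b >-> djoin a b};
  dfun_neg : {morph dfun : a / dneg a >-> dneg a};
  dfun0 : dfun (d0 A) = d0 B;
  dfun1 : dfun (d1 A) = d1 B }.

Lemma demorgan_hom_eq (A B : demorgan_algebra) (f g : demorgan_hom A B) :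
  dfun f = dfun g -> f = g.
Proof.
case: f g => [f fm fj fn f0 f1] [g gm gj gn g0 g1] /= E; subst g.
by congr DeMorganHom; apply: proof_irrelevance.
Qed.

Definition demorgan_id (A : demorgan_algebra) : demorgan_hom A A :=
  @DeMorganHom A A (fun x => x) (fun a b => erefl) (fun a b => erefl)
    (fun a => erefl) erefl erefl.

Definition demorgan_comp (A B C : demorgan_algebra)
    (g : demorgan_hom B C) (f : demorgan_hom A B) : demorgan_hom A C.
Proof.
exists (fun x => g (f x)).
- by move=> a b; rewrite !dfun_meet.
- by move=> a b; rewrite !dfun_join.
- by move=> a; rewrite !dfun_neg.
- by rewrite !dfun0.
- by rewrite !dfun1.
Defined.

Definition demorgan_category : category.
Proof.
exists demorgan_algebra demorgan_hom demorgan_id demorgan_comp.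
- by move=> A B f; apply: demorgan_hom_eq.
- by move=> A B f; apply: demorgan_hom_eq.
- by move=> A B C D h g f; apply: demorgan_hom_eq.
Defined.

(* Main.v *)
From mathcomp Require Import ssreflect ssrfun ssrbool.
From Stdlib Require Import ProofIrrelevance FunctionalExtensionality.
Require Import Defs.

Set Implicit Arguments.
Unset Strict Implicit.
Unset Printing Implicit Defensive.

(** A ternary system carries the operations
      a . b = p(0,a,b),   a o b = p(a,b,1),   ~a = p(1,a,0),
    and a de Morgan algebra carries the ternary operation
      p(a,b,c) = ~b.a o b.c o a.c.
    The last summand is redundant in a Boolean algebra, where p(a,b,c) reads
    as: if b then c else a.  When ~b o b may differ from 1 it is what secures
    p(a,b,a) = a.

    From p to a de Morgan algebra: (T4) says that x |-> p(a,x,c) maps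
    p(b1,b2,b3) to p of the images of b1 and b3, with the same b2 in the middle.
    With (T3) and (T5) it yields associativity of the meet.  It also yields
    ~p(a,b,c) = p(~a,b,~c) and, with (T2), p(a,~b,c) = p(c,b,a); hence, with
    (T1), involution and the de Morgan law.  Finally p(a,b,a) = a yields
    absorption and distributivity.

    From a de Morgan algebra to p: after ~p(a,b,c) = p(~a,b,~c), which expresses
    that the formula for p is self-dual, (T4) is an identity of distributive
    lattices in the elements and their complements; such identities are decided
    by comparing disjunctive normal forms.

    Starting from a de Morgan algebra and returning to it is a computation
    with bounds.  For the other round trip (ternary_median), the inequalities
      b.c <= p(a,b,c),   a.c <= p(a,b,c)
    hold in every ternary system; exchanging a with c and b with ~b, and then
    passing to complements, gives
      ~b.a o b.c o a.c <= p(a,b,c) <= (~b o c).(b o a).(a o c),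
    and both bounds agree in every distributive lattice, so p is recovered from
    the lattice operations.

    Both constructions keep the carrier and the underlying map of a morphism;
    therefore the composite functors are equal to the identities as soon as the
    recovered operations are. *)

(** * Equality of functors and of structures *)

Definition cast (S T : Type) (e : S = T) : S -> T :=
  match e in _ = T' return S -> T' with erefl => id end.

Lemma cast_id (T : Type) (e : T = T) (x : T) : cast e x = x.
Proof. by rewrite (proof_irrelevance _ e erefl). Qed.

(** Functors with equal object parts have morphism parts of different types.
    For a target category whose morphisms are determined by maps of carriers,
    it suffices to compare these maps along the equalities of carriers, where
    transport is harmless. *)
Lemma concrete_functor_eq (C D : category) (U : obj D -> Type)
    (act : forall a b, hom D a b -> U a -> U b)
    (act_inj : forall a b (f g : hom D a b), act a b f =1 act a b g -> f = g)
    (F G : functor C D) (e : forall a, fobj F a = fobj G a) :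
    (forall a b (f : hom C a b) x,
      cast (f_equal U (e b)) (act _ _ (fmor F f) x)
      = act _ _ (fmor G f) (cast (f_equal U (e a)) x)) ->
  F = G.
Proof.
case: F G e => [Fo Fm Fi Fc] [Go Gm Gi Gc] /= e H.
have E : Fo = Go by apply: functional_extensionality.
subst Go.
have Em : Fm = Gm.
  apply: functional_extensionality_dep => a.
  apply: functional_extensionality_dep => b.
  apply: functional_extensionality => f.
  by apply: act_inj => x; have := H a b f x; rewrite !cast_id.
by subst Gm; congr Functor; apply: proof_irrelevance.
Qed.

Lemma ternary_system_eq (A B : ternary_system) (e : tcar A = tcar B) :
    (forall a b c, cast e (tp a b c) = tp (cast e a) (cast e b) (cast e c)) ->
    cast e (t0 A) = t0 B -> cast e (t1 A) = t1 B ->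
  A = B.
Proof.
case: A B e => [T p z o ? ? ? ? ? ? ?] [T' p' z' o' ? ? ? ? ? ? ?] /= e.
subst T' => /= Hp Hz Ho; subst z' o'.
have E : p = p' by do 3![apply: functional_extensionality => ?]; apply: Hp.
by subst p'; congr TernarySystem; apply: proof_irrelevance.
Qed.

Lemma demorgan_algebra_eq (A B : demorgan_algebra) (e : dcar A = dcar B) :
    {morph cast e : a b / dmeet a b >-> dmeet a b} ->
    {morph cast e : a b / djoin a b >-> djoin a b} ->
    {morph cast e : a / dneg a >-> dneg a} ->
    cast e (d0 A) = d0 B -> cast e (d1 A) = d1 B ->
  A = B.
Proof.
case: A B e => [T m j n z o ? ? ? ? ? ? ? ? ? ? ?]
  [T' m' j' n' z' o' ? ? ? ? ? ? ? ? ? ? ?] /= e.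
subst T' => /= Hm Hj Hn Hz Ho; subst z' o'.
have Em : m = m' by do 2![apply: functional_extensionality => ?]; apply: Hm.
have Ej : j = j' by do 2![apply: functional_extensionality => ?]; apply: Hj.
have En : n = n' by apply: functional_extensionality => ?; apply: Hn.
by subst m' j' n'; congr DeMorganAlgebra; apply: proof_irrelevance.
Qed.

(** * Order and lattice identities in a de Morgan algebra *)

Section DeMorganOrder.
Variable A : demorgan_algebra.
Implicit Types a b c x y z : A.

Definition dle a b := dmeet a b = a.

Lemma dmeetxx a : dmeet a a = a.
Proof. by rewrite -{2}(djoin_meetK a a) dmeet_joinK. Qed.

Lemma dle_refl a : dle a a.
Proof. exact: dmeetxx. Qed.

Lemma dle_anti a b : dle a b -> dle b a -> a = b.
Proof. by rewrite /dle => ab ba; rewrite -ab dmeetC ba. Qed.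

Lemma dle_trans b a c : dle a b -> dle b c -> dle a c.
Proof. by rewrite /dle => ab bc; rewrite -ab -dmeetA bc. Qed.

Lemma dle_join a b : dle a b <-> djoin a b = b.
Proof.
split=> [<-|<-]; last exact: dmeet_joinK.
by rewrite djoinC dmeetC djoin_meetK.
Qed.

Lemma dle_meetl a b z : dle a z -> dle (dmeet a b) z.
Proof. by move=> az; rewrite /dle (dmeetC a) -dmeetA az. Qed.

Lemma dle_meetr a b z : dle b z -> dle (dmeet a b) z.
Proof. by rewrite dmeetC; apply: dle_meetl. Qed.

Lemma dle_glb z a b : dle z a -> dle z b -> dle z (dmeet a b).
Proof. by rewrite /dle => za zb; rewrite dmeetA za. Qed.

Lemma dle_joinl z a b : dle z a -> dle z (djoin a b).
Proof. by move=> za; apply: dle_trans za _; apply: dmeet_joinK. Qed.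

Lemma dle_joinr z a b : dle z b -> dle z (djoin a b).
Proof. by rewrite djoinC; apply: dle_joinl. Qed.

Lemma dle_lub a b z : dle a z -> dle b z -> dle (djoin a b) z.
Proof. by move=> az bz; rewrite /dle dmeetC dmeet_joinr !(dmeetC z) az bz. Qed.

Lemma dle_d0 a : dle (d0 A) a.
Proof. by apply/dle_join; rewrite djoinC djoin0. Qed.

Lemma dle_d1 a : dle a (d1 A).
Proof. exact: dmeet1. Qed.

Lemma dmeet_joinl : left_distributive (@dmeet A) (@djoin A).
Proof. by move=> a b c; rewrite dmeetC dmeet_joinr !(dmeetC c). Qed.

Lemma dneg_join a b : dneg (djoin a b) = dmeet (dneg a) (dneg b).
Proof.
rewrite -[LHS]dnegK -(dnegK a) -(dnegK b) djoinC -dneg_meet.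
by rewrite !dnegK.
Qed.

Lemma dle_neg a b : dle a b -> dle (dneg b) (dneg a).
Proof. by move=> ab; apply/dle_join; rewrite -dneg_meet ab. Qed.

Lemma dneg0 : dneg (d0 A) = d1 A.
Proof.
apply: dle_anti; first exact: dle_d1.
by rewrite -(dnegK (d1 A)); apply: dle_neg; apply: dle_d0.
Qed.

Lemma dneg1 : dneg (d1 A) = d0 A.
Proof. by rewrite -dneg0 dnegK. Qed.

End DeMorganOrder.

(** In the free bounded distributive lattice, a meet of generators lies below a
    join of such meets exactly when it contains all the generators of one of
    them.  Distributing meets over joins therefore reduces the identities valid
    in all distributive lattices to a finite search; complements of atoms count
    as further generators. *)
Ltac meet_below_generator :=
  first [ exact: dle_refl | exact: dle_d0 | exact: dle_d1
        | apply: dle_meetl; meet_below_generator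
        | apply: dle_meetr; meet_below_generator ].

Ltac meet_below_join :=
  first [ solve [apply: dle_joinl; meet_below_join]
        | solve [apply: dle_joinr; meet_below_join]
        | solve [repeat apply: dle_glb; meet_below_generator] ].

Ltac lattice_le :=
  rewrite ?(dmeet_joinl, dmeet_joinr); repeat apply: dle_lub; meet_below_join.

Ltac lattice := apply: dle_anti; lattice_le.

(** * The ternary operation of a de Morgan algebra *)

Section TernaryOfDeMorgan.
Variable A : demorgan_algebra.
Implicit Types a b c : A.

Definition dmedian a b c : A :=
  djoin (djoin (dmeet (dneg b) a) (dmeet b c)) (dmeet a c).

(** The dual formula (b o a).(~b o c).(a o c) expands to the formula of the
    median: the extra summands ~b.b.a and ~b.b.c are absorbed by ~b.a and b.c,
    whatever the value of ~b.b. *)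
Lemma dneg_median a b c :
  dneg (dmedian a b c) = dmedian (dneg a) b (dneg c).
Proof. by rewrite /dmedian !dneg_join !dneg_meet !dnegK; lattice. Qed.

Lemma dmedian_01 a : dmedian (d0 A) a (d1 A) = a.
Proof. rewrite /dmedian; lattice. Qed.

Lemma dmedian_left a b : dmedian a (d0 A) b = a.
Proof. rewrite /dmedian dneg0; lattice. Qed.

Lemma dmedian_right a b : dmedian b (d1 A) a = a.
Proof. rewrite /dmedian dneg1; lattice. Qed.

Lemma dmedian_same a b : dmedian a b a = a.
Proof. rewrite /dmedian; lattice. Qed.

(** Only a complement of a median has to be eliminated before the identity
    becomes one of distributive lattices; the mixed products on the right, such
    as ~b1.a.b3.c, are absorbed by a.c. *)
Lemma dmedian_median a b1 b2 b3 c :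
  dmedian a (dmedian b1 b2 b3) c
  = dmedian (dmedian a b1 c) b2 (dmedian a b3 c).
Proof. rewrite {1}/dmedian dneg_median /dmedian; lattice. Qed.

Lemma dmedian_0 a b : dmedian (d0 A) a b = dmeet a b.
Proof. rewrite /dmedian; lattice. Qed.

Lemma dmedian_1 a b : dmedian a b (d1 A) = djoin a b.
Proof. rewrite /dmedian; lattice. Qed.

Lemma dmedian_10 a : dmedian (d1 A) a (d0 A) = dneg a.
Proof. rewrite /dmedian; lattice. Qed.

Lemma dmedian_0C a b : dmedian (d0 A) a b = dmedian (d0 A) b a.
Proof. by rewrite !dmedian_0 dmeetC. Qed.

Lemma dmedian_0xx a : dmedian (d0 A) a a = a.
Proof. by rewrite dmedian_0 dmeetxx. Qed.

Definition ternary_of_demorgan : ternary_system :=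
  TernarySystem dmedian_01 dmedian_left dmedian_right dmedian_same
    dmedian_median dmedian_0C dmedian_0xx.

End TernaryOfDeMorgan.

Lemma dfun_median (A B : demorgan_algebra) (f : demorgan_hom A B) a b c :
  f (dmedian a b c) = dmedian (f a) (f b) (f c).
Proof. by rewrite /dmedian !(dfun_join, dfun_meet, dfun_neg). Qed.

(** * The de Morgan algebra of a ternary system *)

Section DeMorganOfTernary.
Variable A : ternary_system.
Implicit Types a b c x : A.

Definition tmeet a b : A := tp (t0 A) a b.
Definition tjoin a b : A := tp a b (t1 A).
Definition tneg a : A := tp (t1 A) a (t0 A).

(** The complement of the middle argument swaps the outer ones: by (T4),
    p(a,p(1,b,0),c) = p(p(a,1,c),b,p(a,0,c)). *)
Lemma tp_neg a b c : tp a (tneg b) c = tp c b a.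
Proof. by rewrite tp_tp tp_right tp_left. Qed.

Lemma tneg_tp a b c : tneg (tp a b c) = tp (tneg a) b (tneg c).
Proof. exact: tp_tp. Qed.

Lemma tneg0 : tneg (t0 A) = t1 A.
Proof. exact: tp_left. Qed.

Lemma tnegK : involutive tneg.
Proof. by move=> a; rewrite {1}/tneg tp_neg tp_01. Qed.

Lemma tneg_meet a b : tneg (tmeet a b) = tjoin (tneg b) (tneg a).
Proof. by rewrite tneg_tp tneg0 /tjoin tp_neg. Qed.

Lemma tjoin_neg a b : tjoin a b = tneg (tmeet (tneg b) (tneg a)).
Proof. by rewrite tneg_meet !tnegK. Qed.

Lemma tmeetC : commutative tmeet.
Proof. exact: tp_0C. Qed.

Lemma tmeet_tp x a b c : tmeet x (tp a b c) = tp (tmeet x a) b (tmeet x c).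
Proof. by rewrite tmeetC /tmeet tp_tp -!/(tmeet _ _) !(tmeetC x). Qed.

Lemma tmeetCA : left_commutative tmeet.
Proof. by move=> a b c; rewrite [LHS]tmeet_tp {1}/tmeet tp_same. Qed.

Lemma tmeetA : associative tmeet.
Proof. by move=> a b c; rewrite (tmeetC b) tmeetCA tmeetC. Qed.

Lemma tjoinC : commutative tjoin.
Proof. by move=> a b; rewrite !tjoin_neg tmeetC. Qed.

Lemma tjoinA : associative tjoin.
Proof. by move=> a b c; rewrite !tjoin_neg !tnegK tmeetA. Qed.

Lemma tjoin_tp x a b c : tjoin x (tp a b c) = tp (tjoin x a) b (tjoin x c).
Proof. exact: tp_tp. Qed.

(** By (T4), a.p(a,b,1) = p(a.a,b,a.1) = p(a,b,a). *)
Lemma tmeet_joinK a b : tmeet a (tjoin a b) = a.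
Proof. by rewrite tmeet_tp /tmeet tp_0xx tp_01 tp_same. Qed.

Lemma tjoin_meetK a b : tjoin a (tmeet a b) = a.
Proof.
by rewrite tjoin_neg (tneg_meet a) (tjoinC (tneg b)) tmeetC tmeet_joinK tnegK.
Qed.

(** Both sides equal p(a.b,c,a): on the left because a.p(b,c,1) distributes over
    the outer arguments, on the right because a.b o p(0,c,a) does, the last
    argument a.b o a being absorbed to a. *)
Lemma tmeet_joinr : right_distributive tmeet tjoin.
Proof.
move=> a b c; rewrite tmeet_tp (tmeetC a c) [RHS]tjoin_tp.
by rewrite (tjoinC _ a) tjoin_meetK /tmeet /tjoin tp_left tp_01.
Qed.

Lemma tjoin0 : right_id (t0 A) tjoin.
Proof. by move=> a; apply: tp_left. Qed.

Lemma tmeet1 : right_id (t1 A) tmeet.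
Proof. exact: tp_01. Qed.

Definition demorgan_of_ternary : demorgan_algebra :=
  DeMorganAlgebra tmeetA tmeetC tjoinA tjoinC tmeet_joinK tjoin_meetK
    tmeet_joinr tjoin0 tmeet1 tnegK tneg_meet.

Let D := demorgan_of_ternary.

Lemma meet_outer_le_tp a b c : dle (tmeet a c : D) (tp a b c).
Proof.
apply/dle_join; rewrite [LHS]tjoin_tp (tjoinC _ a) tjoin_meetK.
by rewrite tjoinC tmeetC tjoin_meetK.
Qed.

(** Put y = b.c.  As y <= c, one has y.p(a,b,c) = p(y.a,b,y) = y.p(a,b,1), and
    p(a,b,1) = a o b lies above y because y <= b. *)
Lemma meet_right_le_tp a b c : dle (tmeet b c : D) (tp a b c).
Proof.
set y := tmeet b c.
have yc : tmeet y c = tmeet y (t1 A).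
  by rewrite tmeet1 /y -tmeetA; congr tmeet; apply: tp_0xx.
rewrite /dle [LHS]tmeet_tp yc -tmeet_tp.
by apply: (@dle_joinr D); apply: (@dle_meetl D); apply: dle_refl.
Qed.

(** The first summand ~b.a is the case (c, ~b, a) of b.c <= p(a,b,c), since
    p(c,~b,a) = p(a,b,c). *)
Lemma median_le_tp a b c : dle (@dmedian D a b c) (tp a b c).
Proof.
apply: dle_lub; last exact: meet_outer_le_tp.
apply: dle_lub; last exact: meet_right_le_tp.
by rewrite -tp_neg; apply: meet_right_le_tp.
Qed.

(** Both the median and p commute with complements in the outer arguments, so
    the lower bound applied to ~a and ~c is an upper bound. *)
Lemma ternary_median a b c : @dmedian D a b c = tp a b c.
Proof.
apply: dle_anti; first exact: median_le_tp.
have := dle_neg (median_le_tp (tneg a) b (tneg c)).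
by rewrite dneg_median /= tneg_tp !tnegK.
Qed.

End DeMorganOfTernary.

(** * The isomorphism of categories *)

Definition demorgan_hom_of_ternary (A B : ternary_system)
    (f : ternary_hom A B) :
  demorgan_hom (demorgan_of_ternary A) (demorgan_of_ternary B).
Proof.
exists (tfun f) => [a b|a b|a||]; rewrite /= /tmeet /tjoin /tneg.
- by rewrite tfunp tfun0.
- by rewrite tfunp tfun1.
- by rewrite tfunp tfun0 tfun1.
- exact: tfun0.
- exact: tfun1.
Defined.

Definition ternary_hom_of_demorgan (A B : demorgan_algebra)
    (f : demorgan_hom A B) :
  ternary_hom (ternary_of_demorgan A) (ternary_of_demorgan B) :=
  @TernaryHom (ternary_of_demorgan A) (ternary_of_demorgan B) f
    (dfun0 f) (dfun1 f) (dfun_median f).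

Definition demorgan_functor : functor ternary_category demorgan_category.
Proof.
exists (demorgan_of_ternary : obj ternary_category -> obj demorgan_category)
  demorgan_hom_of_ternary.
- by move=> A; apply: demorgan_hom_eq.
- by move=> A B C g f; apply: demorgan_hom_eq.
Defined.

Definition ternary_functor : functor demorgan_category ternary_category.
Proof.
exists (ternary_of_demorgan : obj demorgan_category -> obj ternary_category)
  ternary_hom_of_demorgan.
- by move=> A; apply: ternary_hom_eq.
- by move=> A B C g f; apply: ternary_hom_eq.
Defined.

Lemma demorgan_of_ternaryK A : ternary_of_demorgan (demorgan_of_ternary A) = A.
Proof.
apply: (@ternary_system_eq (ternary_of_demorgan (demorgan_of_ternary A)) A
  erefl) => // a b c.
exact: ternary_median.
Qed.

Lemma ternary_of_demorganK A : demorgan_of_ternary (ternary_of_demorgan A) = A.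
Proof.
apply: (@demorgan_algebra_eq (demorgan_of_ternary (ternary_of_demorgan A)) A
  erefl) => // [a b|a b|a].
- exact: dmedian_0.
- exact: dmedian_1.
- exact: dmedian_10.
Qed.

Theorem theorem4p2 : isomorphic_categories ternary_category demorgan_category.
Proof.
exists demorgan_functor, ternary_functor; split.
- apply: (@concrete_functor_eq _ ternary_category tcar tfun _
    (functor_comp ternary_functor demorgan_functor) (functor_id _)
    demorgan_of_ternaryK) => [A B f g fg|A B f x].
    by apply: ternary_hom_eq; apply: functional_extensionality.
  by rewrite !cast_id.
- apply: (@concrete_functor_eq _ demorgan_category dcar dfun _
    (functor_comp demorgan_functor ternary_functor) (functor_id _)
    ternary_of_demorganK) => [A B f g fg|A B f x].
    by apply: demorgan_hom_eq; apply: functional_extensionality.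
  by rewrite !cast_id.
Qed.
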